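(* Let $N\ge1$, $L,R>0$, $\gamma\ge0$, $\sigma=\gamma/L$. Consider the optimization problem in $y=(y_0,\dots,y_N)$ $$(u_N^{\mathbb L}(\sigma))^2:=\min\Big\{\frac{\sigma^2+\sum_{k=0}^Ny_k}{(N+1)y_0}\ :\ y_0>0,\ y_{k+1}\ge y_k+y_k^2\ \ \forall k\in\{0,\dots,N-1\}\Big\},$$ let $y^\star$ be an optimal solution, and set $$\alpha_k^{\mathbb L}=\frac RL\cdot\frac{N-k}{(N+1)^{3/2}}\cdot\frac{y_k^\star}{y_0^\star\,u_N^{\mathbb L}(\sigma)},\qquad k=0,\dots,N-1.$$ Then any subgradient method with step size schedule $h\in\mathcal H(\alpha^{\mathbb L})$ satisfies $$f(x_{N+1})-f_\star\le\frac{RL}{\sqrt{N+1}}\cdot u_N^{\mathbb L}(\sigma)$$ for every $f\in\mathcal F$, every choice of subgradients $g_k\in\partial f(x_k)$ and all errors with $\sum_{k=0}^{N-1}\|e_k\|^2\le\gamma^2$.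
   Context: Setting. $X$ is a real Hilbert space, $x_0\in X$. $\mathcal F$ is the class of convex $f:X\to\mathbb R$ all of whose subgradients (at all points) have norm at most $L$ and which attain their minimum $f_\star=f(x_\star)$ at some $x_\star$ with $\|x_\star-x_0\|\le R$. Method. A step size schedule is $h=(h_0,\dots,h_N)$ with $h_0,\dots,h_{N-1}\in[0,\infty)$, $h_N\in[0,\infty]$ and $\sum_i h_i>0$. The method is $x_{k+1}=x_k-h_k\tilde g_k$ with $\tilde g_k=g_k+e_k$, $g_k\in\partial f(x_k)$ for $k=0,\dots,N-1$, and $x_{N+1}=\sum_{k=0}^Nh_kx_k/\sum_{k=0}^Nh_k$. If $h_N=\infty$, then $x_{N+1}=x_N$, and for $k<N$ one reads $\sum_{i=k+1}^Nh_i/\sum_{i=0}^Nh_i=1$. Admissibility. $\mathcal H$ is the set of schedules $h$ for which $\frac{1}{N-k}\sum_{j=k+1}^Nh_j$ is nondecreasing in $k\in\{0,\dots,N-1\}$ (always true if $h_N=\infty$). For $\alpha\in\mathbb R^N_{\ge 0}$, $\mathcal H(\alpha)$ is the set of $h\in\mathcal H$ with $h_k\cdot\frac{\sum_{i=k+1}^Nh_i}{\sum_{i=0}^Nh_i}=\alpha_k$ for all $k=0,\dots,N-1$.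
   Formalization: Functions in F are also assumed lower semicontinuous (automatic in finite dimension; without it |l|, l an unbounded linear functional, is a counterexample). For γ=0 the minimum is not attained, so u is an infimum and the claim is stated with the limit ratios y_k*/y_0*=1. *)

(* Defs.v *)
From HB Require Import structures.
From mathcomp Require Import all_boot all_order all_algebra.
From mathcomp Require Import all_classical all_reals all_analysis.

Set Implicit Arguments.
Unset Strict Implicit.
Unset Printing Implicit Defensive.

Import Order.TTheory GRing.Theory Num.Theory.
Import numFieldNormedType.Exports.

Local Open Scope classical_set_scope.
Local Open Scope ring_scope.

(* A real Hilbert space is a complete normed space X together with an inner
   product {dot X for idfun} (symmetric, bilinear, positive definite) which
   induces the norm of X. *)
Definition induces_norm (K : realType) (X : completeNormedModType K)
    (ip : {dot X for idfun}) : Prop :=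
  forall x : X, `|x| ^+ 2 = ip x x.

Definition subgradient (K : realType) (X : completeNormedModType K)
    (ip : {dot X for idfun}) (f : X -> K) (x g : X) : Prop :=
  forall z : X, f x + ip g (z - x) <= f z.

(* Lower semicontinuity is automatic for real-valued convex functions in finite
   dimension.  In infinite dimension it excludes functions such as the absolute
   value of an unbounded linear functional, whose only subgradient at any point
   is 0 although the function is not Lipschitz. *)
Definition convex_class (K : realType) (X : completeNormedModType K)
    (ip : {dot X for idfun}) (x0 : X) (L R : K) (f : X -> K) (xstar : X)
    : Prop :=
  [/\ convex_function [set: convex_lmodType X] f,
      lower_semicontinuous (EFin \o f),
      forall x g : X, subgradient ip f x g -> `|g| <= L,
      forall z : X, f xstar <= f z
    & `|xstar - x0| <= R].

(* A schedule is a function on nat of which only the values at 0, ..., N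
   matter; only the value at N may be infinite. *)
Definition schedule (K : realType) (N : nat) (h : nat -> \bar K) : Prop :=
  [/\ forall k, (k < N)%N -> (0 <= h k < +oo)%E,
      (0 <= h N)%E
    & (0 < \sum_(0 <= i < N.+1) h i)%E].

Definition tail_mean (K : realType) (N : nat) (h : nat -> \bar K) (k : nat)
    : \bar K :=
  (((N - k)%:R^-1)%:E * \sum_(k.+1 <= j < N.+1) h j)%E.

Definition tail_ratio (K : realType) (N : nat) (h : nat -> \bar K) (k : nat)
    : K :=
  if h N == +oo%E then 1
  else (\sum_(k.+1 <= i < N.+1) fine (h i)) / \sum_(0 <= i < N.+1) fine (h i).

Definition admissible (K : realType) (N : nat) (h : nat -> \bar K) : Prop :=
  schedule N h /\
  forall k l, (k <= l)%N -> (l < N)%N -> (tail_mean N h k <= tail_mean N h l)%E.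

Definition admissible_for (K : realType) (N : nat) (alpha : nat -> K)
    (h : nat -> \bar K) : Prop :=
  admissible N h /\
  forall k, (k < N)%N -> fine (h k) * tail_ratio N h k = alpha k.

Definition output (K : realType) (X : completeNormedModType K) (N : nat)
    (h : nat -> \bar K) (x : nat -> X) : X :=
  if h N == +oo%E then x N
  else (\sum_(0 <= k < N.+1) fine (h k))^-1 *:
         \sum_(0 <= k < N.+1) fine (h k) *: x k.

Definition subgradient_run (K : realType) (X : completeNormedModType K)
    (ip : {dot X for idfun}) (f : X -> K) (x0 : X) (N : nat)
    (h : nat -> \bar K) (x g e : nat -> X) : Prop :=
  x 0%N = x0 /\
  forall k, (k < N)%N ->
    subgradient ip f (x k) (g k) /\
    x k.+1 = x k - fine (h k) *: (g k + e k).

Definition guarantees (K : realType) (X : completeNormedModType K)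
    (ip : {dot X for idfun}) (x0 : X) (L R gamma : K) (N : nat)
    (h : nat -> \bar K) (bound : K) : Prop :=
  forall (f : X -> K) (xstar : X) (x g e : nat -> X),
    convex_class ip x0 L R f xstar ->
    subgradient_run ip f x0 N h x g e ->
    \sum_(0 <= k < N) `|e k| ^+ 2 <= gamma ^+ 2 ->
    f (output N h x) - f xstar <= bound.

Definition uL_feasible (K : realType) (N : nat) (y : nat -> K) : Prop :=
  0 < y 0%N /\ forall k, (k < N)%N -> y k + y k ^+ 2 <= y k.+1.

Definition uL_objective (K : realType) (N : nat) (sigma : K) (y : nat -> K)
    : K :=
  (sigma ^+ 2 + \sum_(0 <= k < N.+1) y k) / (N.+1%:R * y 0%N).

Definition uL_optimal (K : realType) (N : nat) (sigma : K) (y : nat -> K)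
    : Prop :=
  uL_feasible N y /\
  forall z : nat -> K, uL_feasible N z ->
    uL_objective N sigma y <= uL_objective N sigma z.

(* The minimum is written as an infimum; it is attained when 0 < sigma, but not
   when sigma = 0 and 0 < N. *)
Definition uL (K : realType) (N : nat) (sigma : K) : K :=
  Num.sqrt (inf [set uL_objective N sigma y | y in uL_feasible N]).

(* rho k stands for the quotient y k / y 0 of an optimal solution y. *)
Definition alphaL (K : realType) (N : nat) (L R sigma : K) (rho : nat -> K)
    (k : nat) : K :=
  R / L * ((N - k)%:R / (N.+1%:R `^ (3 / 2))) * (rho k / uL N sigma).

(* Main.v *)
Require Import Defs.
From HB Require Import structures.
From mathcomp Require Import all_boot all_order all_algebra.
From mathcomp Require Import all_classical all_reals all_analysis.
From mathcomp Require Import ring lra.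

Set Implicit Arguments.
Unset Strict Implicit.
Unset Printing Implicit Defensive.

Import Order.TTheory GRing.Theory Num.Theory.
Import numFieldNormedType.Exports.

Local Open Scope ring_scope.

(** Write mu = 1 / (N + 1), let s_k be the tail ratio of the schedule divided by
    N - k, and put b_k = alpha_k / (N - k), so that h_k s_k = b_k.  The proof
    follows the path
      D_0 = mu (x_0 - xstar),   D_(k+1) = D_k + s_k (x_(k+1) - x_k)
                                     = D_k - b_k (g_k + e_k).

    Summation by parts shows that D_k is a combination of the vectors x_k - x_j
    (j < k) and x_k - xstar, with coefficients s_j - s_(j-1) and mu; they are
    nonnegative because the schedule is admissible and, for s_0 - mu, because
    b_0 <= b_1 (abel_coef0_le).  The subgradient inequalities at x_k
    therefore bound the same combination of differences of values of f by
    <g_k, D_k>.  By the choice of the s_k, the sum of D_0, ..., D_N is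
    x_(N+1) - xstar, whatever schedule realizes the alpha_k, and the
    combinations of values add up to f(x_(N+1)) - f(xstar), the last one being
    controlled by a subgradient g_N at x_(N+1).  Hence
      f(x_(N+1)) - f(xstar) <= <g_0, D_0> + ... + <g_N, D_N>,
    where the right-hand side depends on x_0 - xstar, the g_k and the e_k only.

    With P_i = g_i + ... + g_N, that right-hand side is
      mu <P_0, x_0 - xstar> - sum_i b_i <P_(i+1), g_i + e_i>.
    Completing squares in P_0, ..., P_N bounds it by
      R^2 / (2 (N + 1)^2 b_0) + L^2 (b_0 + ... + b_N) / 2 + theta gamma^2 / 2
    as soon as theta (b_(k+1) - b_k) >= b_k^2.  For b_k = theta y_k this is the
    constraint y_(k+1) >= y_k + y_k^2, and the last two terms become a multiple
    of the objective; b_0 balances them against the first term.  The steps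
    before the choice of the weights are in output_gap_le and sum_ip_path_le,
    the choice itself is in guarantee_optimal.  Without errors it is
    enough that the weights do not decrease, and they can be constant
    (guarantee_noiseless).

    The run provides no subgradient at x_(N+1).  One is found at points
    arbitrarily close to it, through proximal points (subgradient_near), which
    exist by completeness and lower semicontinuity. *)

(** * Abel sums *)

Section Abel.
Context (K : realDomainType).

(** Taken of the iterates x_j instead of the scalars u_j, these sums form the
    path D of the proof; abelv is that version.  The definition by increments
    makes the steps of the path explicit, while abelE exhibits the combination
    of differences u_k - u_j to which the subgradient inequalities apply. *)
Definition abel (c u : nat -> K) (k : nat) : K :=
  c 0%N * u 0%N + \sum_(i < k) c i.+1 * (u i.+1 - u i).

Lemma abelE (c u : nat -> K) k :
  abel c u k = c k * u k - \sum_(j < k) (c j.+1 - c j) * u j.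
Proof.
rewrite /abel; elim: k => [|k IH]; first by rewrite !big_ord0 addr0 subr0.
rewrite !big_ord_recr /= addrA IH; ring.
Qed.

(** Summation by parts turns c_0 u_k - abel c u k into a combination of the
    differences u_j - u_k, with the weights c_(j+1) - c_j. *)
Lemma abel_le (c u : nat -> K) k : 0 <= c 0%N ->
  (forall j, (j < k)%N -> c j <= c j.+1) ->
  (forall j, (j < k)%N -> u k <= u j) -> abel c u k <= c 0%N * u k.
Proof.
move=> c0 c_incr u_min; rewrite abelE.
have -> : c 0%N * u k = c k * u k - \sum_(j < k) (c j.+1 - c j) * u k.
  rewrite -mulr_suml; have -> : \sum_(j < k) (c j.+1 - c j) = c k - c 0%N.
    by rewrite -(telescope_sumr c (leq0n k)) big_mkord.
  ring.
rewrite lerD2l lerN2; apply: ler_sum => j _.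
by rewrite ler_wpM2l ?subr_ge0 ?c_incr ?u_min.
Qed.

(** The coefficient of u_j in the sum of the first n Abel sums: c_j from the
    j-th of them, and c_j - c_(j+1) from each of the n - 1 - j later ones. *)
Definition abel_weight (n : nat) (c : nat -> K) (j : nat) : K :=
  (n%:R - j%:R) * c j - (n%:R - j.+1%:R) * c j.+1.

Lemma sum_abel n (c u : nat -> K) :
  \sum_(k < n) abel c u k = \sum_(j < n) abel_weight n c j * u j.
Proof.
elim: n => [|n IH]; first by rewrite !big_ord0.
rewrite big_ord_recr /= {}IH abelE [RHS]big_ord_recr /=.
rewrite [X in _ = _ + X](_ : _ = c n * u n); last first.
  by rewrite /abel_weight; ring.
rewrite addrCA addrC -sumrB; congr (_ + _); apply: eq_bigr => j _.
rewrite /abel_weight; ring.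
Qed.

(** Both sides agree for the constant sequence v, whose Abel sums are c_0 v, and
    nonnegative weights make the sum of the Abel sums monotone in u. *)
Lemma sum_abel_ge n (c u : nat -> K) (v : K) :
  (forall j, (j < n)%N -> 0 <= abel_weight n c j) ->
  (forall j, (j < n)%N -> v <= u j) ->
  n%:R * c 0%N * v <= \sum_(k < n) abel c u k.
Proof.
move=> w_ge0 v_le.
have -> : n%:R * c 0%N * v = \sum_(k < n) abel c (fun=> v) k.
  rewrite (eq_bigr (fun=> c 0%N * v)); last first.
    by move=> k _; rewrite /abel big1 ?addr0 // => i _; rewrite subrr mulr0.
  by rewrite sumr_const card_ord -[RHS]mulr_natl mulrA.
rewrite !sum_abel; apply: ler_sum => j _.
by rewrite ler_wpM2l ?w_ge0 ?v_le.
Qed.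

End Abel.

Lemma sum_scale_tail (R : pzRingType) (V : lmodType R) n
    (a : nat -> R) (x : nat -> V) :
  \sum_(0 <= k < n.+1) a k *: x k = (\sum_(0 <= k < n.+1) a k) *: x 0%N +
    \sum_(i < n) (\sum_(i.+1 <= j < n.+1) a j) *: (x i.+1 - x i).
Proof.
elim: n => [|n IH]; first by rewrite !big_nat1 big_ord0 addr0.
rewrite big_nat_recr //= {}IH [in RHS]big_nat_recr //= scalerDl.
rewrite -!addrA; congr (_ + _); rewrite big_ord_recr /= big_nat1.
rewrite [in RHS](eq_bigr (fun i : 'I_n =>
   (\sum_(i.+1 <= j < n.+1) a j) *: (x i.+1 - x i)
   + a n.+1 *: (x i.+1 - x i))); last first.
  by move=> i _; rewrite big_nat_recr ?scalerDl // ltnS ltnW.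
rewrite big_split /= -scaler_sumr -(big_mkord xpredT (fun i => x i.+1 - x i)).
rewrite telescope_sumr // -addrA [RHS]addrCA -!scalerDr; congr (_ + _ *: _).
by rewrite addrA [x 0%N + _]addrC subrK addrC subrK.
Qed.

(** * Subgradients in a Hilbert space *)

Section Hilbert.
Context (K : realType) (X : completeNormedModType K).
Context (ip : {dot X for idfun}) (ip_norm : induces_norm ip).
Implicit Types (x y z u v w : X) (f : X -> K).

Lemma ipC u v : ip u v = ip v u.
Proof. by have := @hermitian_subproof _ _ _ _ ip u v; rewrite expr0 mul1r. Qed.

Lemma ipDl u v w : ip (u + v) w = ip u w + ip v w.
Proof. exact: linearDl. Qed.

Lemma ipDr u v w : ip u (v + w) = ip u v + ip u w.
Proof. exact: linearDr. Qed.

Lemma ipNl u v : ip (- u) v = - ip u v.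
Proof. exact: linearNl. Qed.

Lemma ipNr u v : ip u (- v) = - ip u v.
Proof. exact: linearNr. Qed.

Lemma ipZl a u v : ip (a *: u) v = a * ip u v.
Proof. exact: linearZl_LR. Qed.

Lemma ipZr a u v : ip u (a *: v) = a * ip u v.
Proof. exact: linearZr_LR. Qed.

Lemma ip_sumr (I : Type) (r : seq I) (P : pred I) (E : I -> X) u :
  ip u (\sum_(i <- r | P i) E i) = \sum_(i <- r | P i) ip u (E i).
Proof. exact: linear_sumr. Qed.

Lemma ip_ge0 u : 0 <= ip u u.
Proof. by rewrite -ip_norm exprn_ge0. Qed.

Lemma ip_le_norm u v : ip u v <= `|u| * `|v|.
Proof.
have [->|v0] := eqVneq v 0; first by rewrite linear0r normr0 mulr0.
have [->|u0] := eqVneq u 0; first by rewrite linear0l normr0 mul0r.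
have := ip_ge0 (`|v| *: u - `|u| *: v).
rewrite !(ipDl, ipDr, ipNl, ipNr, ipZl, ipZr) -!ip_norm (ipC v u) => H.
have up : 0 < `|u| by rewrite normr_gt0.
have vp : 0 < `|v| by rewrite normr_gt0.
rewrite -(ler_pM2l (mulr_gt0 up vp)); nra.
Qed.

Lemma sqr_norm_le u (a : K) : `|u| <= a -> `|u| ^+ 2 <= a ^+ 2.
Proof. by move=> ua; rewrite lerXn2r ?nnegrE ?(le_trans _ ua). Qed.

Lemma normD_sqr u v : `|u + v| ^+ 2 = `|u| ^+ 2 + 2 * ip u v + `|v| ^+ 2.
Proof. by rewrite !ip_norm !(ipDl, ipDr) (ipC v u); ring. Qed.

Lemma norm_midpoint u v w :
  `|2^-1 *: (u + v) - w| ^+ 2 =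
  (`|u - w| ^+ 2 + `|v - w| ^+ 2) / 2 - `|u - v| ^+ 2 / 4.
Proof.
rewrite !ip_norm !(ipDl, ipDr, ipNl, ipNr, ipZl, ipZr).
rewrite (ipC v u) (ipC w u) (ipC w v); lra.
Qed.

(** By the midpoint inequality two points whose values are close to the infimum
    are close to each other: minimizing sequences are Cauchy.  Completeness
    thus replaces compactness. *)
Lemma strongly_convex_min (phi : X -> K) (b kappa : K) :
  0 < kappa ->
  lower_semicontinuous (EFin \o phi) ->
  (forall x, b <= phi x) ->
  (forall u v, phi (2^-1 *: (u + v)) <=
     (phi u + phi v) / 2 - kappa * `|u - v| ^+ 2) ->
  exists p, forall x, phi p <= phi x.
Proof.
move=> k0 lsc_phi phi_ge conv_phi.
pose m := inf (range phi).
have m_le x : m <= phi x.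
  by apply: ge_inf; [exists b => _ [y _ <-]; exact: phi_ge|exists x].
have ex_z (n : nat) : exists x, phi x < m + harmonic n.
  have has_inf_phi : has_inf (range phi).
    by split; [exists (phi 0), 0|exists b => _ [y _ <-]; exact: phi_ge].
  have n0 : 0 < harmonic n :> K by exact: harmonic_gt0.
  have [_ [x _ <-] lt_x] := inf_adherent n0 has_inf_phi.
  by exists x.
have [z z_lt] := choice ex_z.
have cvg_z : cvg (z @ \oo)%classic.
  apply: cauchy_cvg; apply: cauchy_exP => eps eps0.
  have ke : 0 < kappa * eps ^+ 2 by rewrite mulr_gt0 ?exprn_gt0.
  have := near_infty_natSinv_lt (PosNum ke).
  move=> [n _ /(_ n (leqnn n)) n_lt].
  have {}n_lt : harmonic n < kappa * eps ^+ 2 := n_lt.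
  exists (z n); exists n => // k /= n_le_k.
  rewrite -ball_normE /=.
  rewrite -(ltr_pXn2r (n := 2)) ?nnegrE ?normr_ge0 ?(ltW eps0) //.
  rewrite -(ltr_pM2l k0).
  have := conv_phi (z n) (z k); have := m_le (2^-1 *: (z n + z k)).
  have := z_lt n; have := z_lt k.
  have : harmonic k <= harmonic n :> K by rewrite lef_pV2 ?posrE // ler_nat.
  move=> *; lra.
pose p := lim (z @ \oo)%classic.
exists p => x; apply: le_trans (m_le x); rewrite leNgt; apply/negP => m_lt.
have mid_lt : (((m + phi p) / 2)%:E < (EFin \o phi) p)%E.
  by rewrite lte_fin; exact: (midf_lt m_lt).2.
(* near p the values of phi stay above the midpoint of m and phi p, whereas
   they tend to m along the sequence *)
have [V nV V_gt] := lsc_phi p _ mid_lt.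
have e0 : 0 < (phi p - m) / 2 by rewrite divr_gt0 // subr_gt0.
near \oo%classic => n.
have zV : V (z n) by near: n; exact: cvg_z.
have n_lt : harmonic n < (phi p - m) / 2.
  by near: n; exact: (near_infty_natSinv_lt (PosNum e0)).
have := V_gt _ zV; rewrite lte_fin /=; have := z_lt n; lra.
Unshelve. all: by end_near.
Qed.

Lemma lsc_add f (q : X -> K) :
  lower_semicontinuous (EFin \o f) -> continuous q ->
  lower_semicontinuous (EFin \o (fun x => f x + q x)).
Proof.
move=> lsc_f cont_q x a; rewrite /= lte_fin => a_lt.
have d0 : 0 < (f x + q x - a) / 2 by rewrite divr_gt0 // subr_gt0.
have [|V nV V_gt] := lsc_f x (f x - (f x + q x - a) / 2).
  by rewrite /= lte_fin ltrBlDr ltrDl.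
have /cvgrPdist_lt/(_ _ d0)/(filterI nV) nW := cont_q x.
eexists; first exact: nW.
move=> y [/V_gt]; rewrite /= !lte_fin ltr_norml => f_lt /andP[_ q_lt].
move=> *; lra.
Qed.

Lemma convexP f : convex_function [set: convex_lmodType X]%classic f ->
  forall (t : K) u v, 0 <= t <= 1 ->
  f (t *: u + (1 - t) *: v) <= t * f u + (1 - t) * f v.
Proof.
move=> cf t u v t01.
pose tt : {i01 K} := Itv01 (andP t01).1 (andP t01).2.
by have := cf tt u v; rewrite !inE => /(_ I I).
Qed.

(** The minimizer p of f + |. - x|^2 / (2 lam) solves the inclusion
    x - p in lam times the subdifferential at p, by comparison with the points
    of the segments that start at p.  This yields subgradients without
    a separation theorem. *)
Lemma subgradient_prox f (b lam : K) x : 0 < lam ->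
  convex_function [set: convex_lmodType X]%classic f ->
  lower_semicontinuous (EFin \o f) -> (forall z, b <= f z) ->
  exists p, subgradient ip f p (lam^-1 *: (x - p)).
Proof.
move=> lam0 /convexP cf lsc_f f_ge.
have q0 : 0 < (2 * lam)^-1 by rewrite invr_gt0 mulr_gt0.
pose phi z := f z + (2 * lam)^-1 * `|z - x| ^+ 2.
have [||z|u v|p p_min] := @strongly_convex_min phi b ((2 * lam)^-1 / 4).
- by rewrite divr_gt0.
- apply: lsc_add => // z; apply: cvgM; first exact: cvg_cst.
  have cvg_norm_sub : (`|y - x| @[y --> z] --> `|z - x|)%classic.
    by apply: cvg_norm; apply: cvgB => //; exact: cvg_cst.
  exact: (continuous_cvg _ (@exprn_continuous _ 2 _) cvg_norm_sub).
- rewrite (le_trans (f_ge z)) // lerDl mulr_ge0 ?exprn_ge0 //.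
  exact: ltW.
- rewrite /phi norm_midpoint.
  have := cf 2^-1 u v; rewrite (_ : 1 - 2^-1 = 2^-1); last lra.
  rewrite scalerDr => /(_ ltac:(lra)); nra.
exists p => z; rewrite ipZl -lerBrDl -subr_ge0 -oppr_le0.
apply/ler_addgt0Pl => eps eps0; rewrite addr0.
set c := (2 * lam)^-1 in q0 phi p_min.
have cQ0 : 0 <= c * `|z - p| ^+ 2 by rewrite mulr_ge0 ?exprn_ge0 // ltW.
set cQ := c * _ in cQ0.
have d0 : 0 < eps + cQ by lra.
(* any t in (0, 1] with t * cQ <= eps makes the quadratic remainder small *)
pose t := eps / (eps + cQ).
have t0 : 0 < t by rewrite divr_gt0.
have t1 : t <= 1 by rewrite ler_pdivrMr // mul1r lerDl.
have tQ : t * cQ <= eps.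
  by rewrite mulrAC ler_pdivrMr // ler_pM2l // lerDr ltW.
have := le_trans (p_min (t *: z + (1 - t) *: p))
  (lerD (cf t z p (ltac:(lra))) (lexx _)).
have -> : t *: z + (1 - t) *: p - x = (p - x) + t *: (z - p).
  by rewrite scalerBl scale1r scalerBr [RHS]addrAC [in RHS]addrCA.
rewrite /phi (normD_sqr (p - x)) ipZr normrZ exprMn real_normK ?num_real //.
have -> : lam^-1 = 2 * c by rewrite /c; field; lra.
rewrite -(opprB p x) ipNl; move: tQ; rewrite /cQ.
set Q := `|z - p| ^+ 2; set I := ip _ _ => tQ p_le.
rewrite -(ler_pM2l t0); nra.
Qed.

(** A proximal point p moves by at most lam times the norm of a subgradient,
    hence by at most lam * L, and tends to x with lam.  The value f x
    is controlled by f p through lower semicontinuity alone. *)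
Lemma subgradient_near f (b L : K) x (eps : K) : 0 < eps ->
  convex_function [set: convex_lmodType X]%classic f ->
  lower_semicontinuous (EFin \o f) -> (forall z, b <= f z) ->
  (forall y g, subgradient ip f y g -> `|g| <= L) ->
  exists p g, [/\ subgradient ip f p g, `|x - p| <= eps & f x <= f p + eps].
Proof.
move=> eps0 cf lsc_f f_ge g_le.
have [|V nV V_gt] := lsc_f x (f x - eps).
  by rewrite lte_fin ltrBlDr ltrDl.
move: nV => /nbhs_normP [d /= d0 dV].
pose r := Num.min eps (d / 2).
have r0 : 0 < r by rewrite lt_min eps0 divr_gt0.
have L1 : 0 < `|L| + 1 by rewrite ltr_wpDl.
have lam0 : 0 < r / (`|L| + 1) by rewrite divr_gt0.
have [p sub_p] := subgradient_prox x lam0 cf lsc_f f_ge.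
have xp : `|x - p| <= r.
  have := g_le _ _ sub_p; rewrite normrZ gtr0_norm ?invr_gt0 //.
  rewrite ler_pdivrMl // => /le_trans; apply.
  rewrite mulrAC ler_pdivrMr // ler_pM2l //.
  by rewrite (le_trans (ler_norm L)) // lerDl.
exists p, ((r / (`|L| + 1))^-1 *: (x - p)); split => //.
  by rewrite (le_trans xp) // ge_min lexx.
have /V_gt : V p.
  apply: dV; rewrite /= (le_lt_trans xp) // gt_min; apply/orP; right.
  by rewrite ltr_pdivrMr // ltr_pMr // ltrDl.
by rewrite /= lte_fin ltrBlDr => /ltW.
Qed.

(** * From subgradient inequalities to a bound on the final gap *)

(** With P_i = g_i + ... + g_n, the inner products along the path D add up to
    <P_0, D_0> minus the terms b_i <P_(i+1), g_i + e_i>.  Since P_i = P_(i+1) +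
    g_i, the part b_i <P_(i+1), g_i> is half the difference of b_i |P_i|^2 and
    b_i |P_(i+1)|^2 up to b_i |g_i|^2.  What remains is one term per step, which
    couples the error e_i to the growth b_(i+1) - b_i of the weights and which
    eta bounds. *)
Lemma sum_ip_path_le (n : nat) (L : K) (b eta : nat -> K) (g e D : nat -> X) :
  (forall k, (k < n)%N -> D k.+1 = D k - b k *: (g k + e k)) ->
  (forall k, (k <= n)%N -> 0 <= b k) ->
  (forall k, (k <= n)%N -> `|g k| <= L) ->
  (forall k v, (k < n)%N ->
     - b k * ip v (e k) - (b k.+1 - b k) / 2 * `|v| ^+ 2 <= eta k) ->
  \sum_(k < n.+1) ip (g k) (D k) <=
    ip (\sum_(k < n.+1) g k) (D 0%N) - b 0%N / 2 * `|\sum_(k < n.+1) g k| ^+ 2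
    + L ^+ 2 / 2 * (\sum_(k < n.+1) b k) + \sum_(k < n) eta k.
Proof.
elim: n b eta g e D => [|n IH] b eta g e D stepD b_ge0 g_le eta_ge.
  rewrite !big_ord_recl !big_ord0 !addr0.
  have gL : `|g 0%N| ^+ 2 <= L ^+ 2 by apply: sqr_norm_le; exact: g_le.
  have := b_ge0 0%N isT; nra.
rewrite [leLHS]big_ord_recl [in leRHS]big_ord_recl.
rewrite [\sum_(k < n.+2) b k]big_ord_recl [\sum_(k < n.+1) eta k]big_ord_recl.
have := IH (fun k => b k.+1) (fun k => eta k.+1) (fun k => g k.+1)
  (fun k => e k.+1) (fun k => D k.+1).
rewrite /= => /(_ (fun k => stepD k.+1) (fun k => b_ge0 k.+1)).
move=> /(_ (fun k => g_le k.+1) (fun k v => eta_ge k.+1 v)).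
rewrite stepD // [ip _ (D 0%N - _)]ipDr ipNr ipZr ipDr.
have := eta_ge 0%N (\sum_(i < n.+1) g (bump 0 i)) isT.
rewrite /bump /=; set P := \sum_(i < n.+1) _ => eta0.
rewrite ipDl normD_sqr (ipC (g 0%N) P).
have gL : `|g 0%N| ^+ 2 <= L ^+ 2 by apply: sqr_norm_le; exact: g_le.
have := b_ge0 0%N isT; nra.
Qed.

Definition abelv (c : nat -> K) (x : nat -> X) (xs : X) (k : nat) : X :=
  c 0%N *: (x 0%N - xs) + \sum_(i < k) c i.+1 *: (x i.+1 - x i).

Lemma ip_abelv c (x : nat -> X) xs v k :
  ip v (abelv c x xs k) = abel c (fun j => ip v (x j - xs)) k.
Proof.
rewrite /abelv /abel [LHS]ipDr ipZr ip_sumr; congr (_ + _).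
apply: eq_bigr => i _; rewrite ipZr; congr (_ * _).
by rewrite !(ipDr, ipNr); ring.
Qed.

Lemma sum_abelv n c (x : nat -> X) xs :
  \sum_(k < n.+1) abelv c x xs k = (n.+1%:R * c 0%N) *: (x 0%N - xs) +
    \sum_(i < n) ((n%:R - i%:R) * c i.+1) *: (x i.+1 - x i).
Proof.
elim: n => [|n IH].
  by rewrite big_ord_recl !big_ord0 /abelv big_ord0 !addr0 mul1r.
rewrite big_ord_recr /= {}IH /abelv addrACA -scalerDl; congr (_ *: _ + _).
  by rewrite -[in RHS]natr1; ring.
rewrite [in LHS]big_ord_recr [RHS]big_ord_recr /= addrA -big_split /=.
congr (_ + _ *: _); last by rewrite -natr1; ring.
apply: eq_bigr => i _; rewrite -scalerDl; congr (_ *: _).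
by rewrite -natr1; ring.
Qed.

(** Let D_k be the Abel sum of the increments of the iterates, started at
    c_0 (x_0 - xstar).  The subgradient inequalities at x_k towards the earlier
    iterates and xstar say that the corresponding Abel sum of the values
    f(x_j) - f(xstar) is at most <g_k, D_k>.  The D_k with k <= n add up to
    w - xstar, and what the first n Abel sums of values leave of
    f(w) - f(xstar) is likewise bounded by <g, D_n> for a subgradient g at w.
    As D also is a path whose steps are - b_k (g_k + e_k), sum_ip_path_le
    applies, and completing the square in the sum of the subgradients removes
    the dependence on them. *)
Lemma output_gap_le n (x0 xstar : X) (L R : K) f (h b c eta : nat -> K)
    (x g e : nat -> X) (w : X) :
  convex_class ip x0 L R f xstar -> x 0%N = x0 ->
  (forall k, (k < n)%N ->
     subgradient ip f (x k) (g k) /\ x k.+1 = x k - h k *: (g k + e k)) ->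
  w = x0 + \sum_(i < n) ((n%:R - i%:R) * c i.+1) *: (x i.+1 - x i) ->
  c 0%N = n.+1%:R^-1 ->
  (forall k, (k.+1 < n)%N -> c k <= c k.+1) ->
  (forall k, (k < n)%N -> 0 <= abel_weight n c k) ->
  (forall k, (k < n)%N -> h k * c k.+1 = b k) ->
  0 < b 0%N -> (forall k, (k <= n)%N -> 0 <= b k) ->
  (forall k v, (k < n)%N ->
     - b k * ip v (e k) - (b k.+1 - b k) / 2 * `|v| ^+ 2 <= eta k) ->
  f w - f xstar <= R ^+ 2 / (2 * n.+1%:R ^+ 2 * b 0%N)
    + L ^+ 2 / 2 * (\sum_(k < n.+1) b k) + \sum_(k < n) eta k.
Proof.
move=> [cvx_f lsc_f g_le f_ge xsR] x0E run wE c0E c_incr weight_ge0.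
move=> hcb b0 b_ge0 eta_ge.
have c0_ge0 : 0 <= c 0%N by rewrite c0E invr_ge0.
have n1c0 : n.+1%:R * c 0%N = 1 by rewrite c0E divff ?pnatr_eq0.
pose D := abelv c x xstar.
have sumD : \sum_(k < n.+1) D k = w - xstar.
  by rewrite sum_abelv n1c0 scale1r wE x0E addrAC.
have L0 : 0 <= L.
  have [p [gp [sub_p _ _]]] := subgradient_near x0 ltr01 cvx_f lsc_f f_ge g_le.
  exact: le_trans (normr_ge0 _) (g_le _ _ sub_p).
pose phi k := f (x k) - f xstar.
have abel_u v k :
    abel c (fun j => phi j - ip v (x j - xstar)) k = abel c phi k - ip v (D k).
  rewrite ip_abelv !abelE.
  under [X in _ - X = _]eq_bigr do rewrite mulrBr.
  by rewrite sumrB; ring.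
have phi_le k : (k < n)%N -> abel c phi k <= ip (g k) (D k).
  move=> kn; have [sub_k _] := run k kn.
  (* u is minimal at k and nonpositive there, by the subgradient inequality
     towards x_j and towards xstar *)
  pose u j := phi j - ip (g k) (x j - xstar).
  rewrite -subr_le0 -abel_u -/u; apply: (@le_trans _ _ (c 0%N * u k)).
    apply: abel_le => // j jk; first by rewrite c_incr // (leq_trans _ kn).
    have := sub_k (x j); rewrite /u /phi !(ipDr, ipNr); lra.
  have := sub_k xstar; rewrite /u /phi !(ipDr, ipNr) => sub_s.
  by rewrite mulr_ge0_le0 //; lra.
(* a subgradient is available only near w; the resulting loss eps * (1 + L) is
   arbitrarily small *)
have main (eps : K) : 0 < eps -> f w - f xstar <=
  R ^+ 2 / (2 * n.+1%:R ^+ 2 * b 0%N) + L ^+ 2 / 2 * (\sum_(k < n.+1) b k)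
  + \sum_(k < n) eta k + eps * (1 + L).
  move=> eps0.
  have [p [gp [sub_p wp fwp]]] :=
    subgradient_near w eps0 cvx_f lsc_f f_ge g_le.
  have gpL := g_le _ _ sub_p.
  have last_le : f w - f xstar - \sum_(k < n) abel c phi k
      <= ip gp (D n) + eps * (1 + L).
    pose u j := phi j - ip gp (x j - xstar).
    have up_le j : f p - f xstar - ip gp (p - xstar) <= u j.
      by have := sub_p (x j); rewrite /u /phi !(ipDr, ipNr); lra.
    have := sum_abel_ge weight_ge0 (fun j _ => up_le j).
    under eq_bigr do rewrite /u abel_u.
    rewrite sumrB -ip_sumr.
    have -> : \sum_(k < n) D k = w - xstar - D n.
      by rewrite -sumD big_ord_recr /= addrK.
    have nc01 : n%:R * c 0%N <= 1.
      by rewrite -[leRHS]n1c0 ler_wpM2r // ler_nat.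
    have pw_le : ip gp (p - w) <= L * eps.
      rewrite (le_trans (ip_le_norm _ _)) // ler_pM // distrC //.
    have := sub_p xstar; move: pw_le.
    rewrite !(ipDr, ipNr) => pw_le sub_s sum_ge.
    have V_le0 : f p - f xstar - (ip gp p - ip gp xstar) <= 0 by lra.
    have nc_ge0 : 0 <= 1 - n%:R * c 0%N by rewrite subr_ge0.
    have := mulr_ge0_le0 nc_ge0 V_le0.
    lra.
  (* the subgradient at p plays the role of the missing g_n *)
  pose g' k := if (k < n)%N then g k else gp.
  have stepD k : (k < n)%N -> D k.+1 = D k - b k *: (g' k + e k).
    move=> kn; rewrite /D /abelv big_ord_recr /= addrA /g' kn.
    have -> : x k.+1 - x k = - (h k *: (g k + e k)).
      by rewrite (run k kn).2 addrAC subrr add0r.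
    by rewrite -(hcb k kn) scalerN scalerA mulrC.
  have g'_le k : (k <= n)%N -> `|g' k| <= L.
    move=> _; rewrite /g'; case: ifP => // kn.
    exact: g_le (run k kn).1.
  have := sum_ip_path_le stepD b_ge0 g'_le eta_ge.
  rewrite [in X in X <= _]big_ord_recr /= {2}/g' ltnn.
  have : \sum_(k < n) abel c phi k <= \sum_(k < n) ip (g' k) (D k).
    by apply: ler_sum => k _; rewrite /g' ltn_ord phi_le.
  set P := \sum_(k < n.+1) g' k.
  have : ip P (D 0%N) - b 0%N / 2 * `|P| ^+ 2
      <= R ^+ 2 / (2 * n.+1%:R ^+ 2 * b 0%N).
    rewrite /D /abelv big_ord0 addr0 ipZr c0E x0E.
    have := ip_le_norm P (x0 - xstar); rewrite (distrC x0) => PD.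
    have PR : ip P (x0 - xstar) <= `|P| * R.
      by apply: le_trans PD _; rewrite ler_wpM2l.
    set m := n.+1%:R in PR *; have m0 : 0 < m by rewrite ltr0n.
    have -> : R ^+ 2 / (2 * m ^+ 2 * b 0%N) =
      m^-1 * (`|P| * R) - b 0%N / 2 * `|P| ^+ 2 +
      (R / m - b 0%N * `|P|) ^+ 2 / (2 * b 0%N).
      by field; rewrite !gt_eqF.
    apply: ler_wpDr; first by rewrite divr_ge0 ?sqr_ge0 // mulr_ge0 // ltW.
    by rewrite lerD2r ler_wpM2l // invr_ge0 ltW.
  set A := _ / (_ * b 0%N); lra.
apply/ler_addgt0Pr => eps eps0.
have L1 : 0 < 1 + L by lra.
by have := main (eps / (1 + L)) (divr_gt0 eps0 L1); rewrite divfK // gt_eqF.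
Qed.

End Hilbert.

(** * Step size schedules *)

Section Schedule.
Context (K : realType).
Implicit Types (N : nat) (h : nat -> \bar K).

Lemma schedule_fin N h k : schedule N h -> h N != +oo%E -> (k <= N)%N ->
  h k = (fine (h k))%:E /\ 0 <= fine (h k).
Proof.
move=> [h_fin hN0 _] hN; rewrite leq_eqVlt => /predU1P[->|/h_fin].
  by rewrite fine_ge0 // fineK // fin_numE hN gt_eqF // (lt_le_trans _ hN0).
move=> /andP[h0 h_lt]; rewrite fine_ge0 // fineK // ge0_fin_numE //.
Qed.

Lemma schedule_sum_gt0 N h : schedule N h -> h N != +oo%E ->
  0 < \sum_(0 <= i < N.+1) fine (h i).
Proof.
move=> sch hN; have [_ _] := sch.
rewrite (eq_big_nat _ _ (F2 := fun i => (fine (h i))%:E)) ?sumEFin ?lte_fin //.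
by move=> i /andP[_ iN]; have [] := schedule_fin sch hN iN.
Qed.

(** The factor of the k-th step in the output is exactly the quantity that the
    admissibility condition prescribes; the averaging and the last-iterate
    output thereby get the same form. *)
Lemma outputE (X : completeNormedModType K) N h (x : nat -> X) :
  schedule N h ->
  output N h x = x 0%N + \sum_(i < N) tail_ratio N h i *: (x i.+1 - x i).
Proof.
move=> sch; rewrite /output /tail_ratio; case: ifPn => [_|hN].
  under eq_bigr do rewrite scale1r.
  rewrite -(big_mkord xpredT (fun i => x i.+1 - x i)) telescope_sumr //.
  by rewrite addrC subrK.
have H0 := schedule_sum_gt0 sch hN.
rewrite sum_scale_tail scalerDr scalerA mulVf ?scale1r ?gt_eqF //.
rewrite scaler_sumr; congr (_ + _); apply: eq_bigr => i _.
by rewrite scalerA mulrC.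
Qed.

Lemma tail_ratio_ge0 N h k : schedule N h -> 0 <= tail_ratio N h k.
Proof.
move=> sch; rewrite /tail_ratio; case: ifPn => // hN.
rewrite divr_ge0 ?(ltW (schedule_sum_gt0 sch hN)) // big_nat_cond sumr_ge0 //.
by move=> i /andP[/andP[_ iN] _]; have [] := schedule_fin sch hN iN.
Qed.

(** Consecutive tail sums differ by one step; for k = 0 the value 1 is the ratio
    of the full sum to itself. *)
Lemma tail_ratioS N h k : schedule N h -> h N != +oo%E -> (k < N)%N ->
  fine (h k) = (\sum_(0 <= i < N.+1) fine (h i)) *
    ((if k is i.+1 then tail_ratio N h i else 1) - tail_ratio N h k).
Proof.
move=> sch hN kN; have H0 := schedule_sum_gt0 sch hN.
rewrite /tail_ratio (negPf hN).
set H := \sum_(0 <= i < _) _ in H0 *.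
have tailE : \sum_(k <= i < N.+1) fine (h i) =
    fine (h k) + \sum_(k.+1 <= i < N.+1) fine (h i).
  by rewrite big_ltn // ltnS ltnW.
case: k kN tailE => [|k] kN tailE.
  by rewrite mulrBr mulr1 mulrCA divff ?gt_eqF // mulr1 [H]tailE addrK.
by rewrite -mulrBl mulrCA divff ?gt_eqF // mulr1 tailE addrK.
Qed.

Lemma tail_ratio_le N h k : schedule N h -> (k < N)%N ->
  tail_ratio N h k <= if k is i.+1 then tail_ratio N h i else 1.
Proof.
move=> sch kN; have [hN|hN] := eqVneq (h N) +oo%E.
  by rewrite /tail_ratio hN eqxx; case: k kN.
have := tail_ratioS sch hN kN; have H0 := schedule_sum_gt0 sch hN.
have [_ h0] := schedule_fin sch hN (ltnW kN).
move=> hE; rewrite -subr_ge0 -(pmulr_rge0 _ H0) -hE //.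
Qed.

Lemma tail_ratio_mean_incr N h k : admissible N h -> (k.+1 < N)%N ->
  tail_ratio N h k / (N%:R - k%:R) <= tail_ratio N h k.+1 / (N%:R - k.+1%:R).
Proof.
move=> [sch incr] kN.
have d0 : 0 < N%:R - k.+1%:R :> K by rewrite subr_gt0 ltr_nat.
rewrite /tail_ratio; case: ifPn => [_|hN].
  rewrite !div1r lef_pV2 ?posrE //; first by rewrite lerD2l lerN2 ler_nat.
  by rewrite subr_gt0 ltr_nat ltnW.
have H0 := schedule_sum_gt0 sch hN.
rewrite [leLHS]mulrAC [leRHS]mulrAC ler_pM2r ?invr_gt0 //.
have := incr k k.+1 (leqnSn _) kN.
have tmE l : (l < N)%N -> tail_mean N h l =
    ((\sum_(l.+1 <= i < N.+1) fine (h i)) / (N%:R - l%:R))%:E.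
  move=> lN; rewrite /tail_mean -natrB ?(ltnW lN) // mulrC EFinM -sumEFin.
  congr (_ * _)%E; apply: eq_big_nat => i /andP[_ iN].
  by have [] := schedule_fin sch hN iN.
by rewrite !tmE ?(ltnW kN) // lee_fin.
Qed.

(** The coefficients for which the D_k of output_gap_le sum to the output: the
    initial value gives the weight 1 to x_0 - xstar in a sum of N + 1 terms, and
    the increment x_(i+1) - x_i occurs in N - i of them. *)
Definition abel_coef N h (k : nat) : K :=
  if k is i.+1 then tail_ratio N h i / (N%:R - i%:R) else N.+1%:R^-1.

(** Admissibility compares the tail means only from k = 0 on, so the comparison
    with the mean over all indices has to come from the prescribed step sizes.
    When h_N is finite, let H be the sum of all steps, r_k the tail ratio,
    r_(-1) = 1 and s_k = r_k / (N - k); then b_k = H (r_(k-1) - r_k) s_k.  If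
    s_0 < 1 / (N + 1), then b_0 <= b_1 would force
    ((N - 1) s_1 - s_0) (s_1 - s_0) < 0, against s_0 <= s_1. *)
Lemma abel_coef0_le N h (b : nat -> K) :
  admissible N h ->
  (forall k, (k < N)%N ->
     fine (h k) * tail_ratio N h k = (N%:R - k%:R) * b k) ->
  0 < b 0%N -> (1 < N)%N -> b 0%N <= b 1%N ->
  abel_coef N h 0 <= abel_coef N h 1.
Proof.
move=> adm hr b0 N1 b01; have [sch _] := adm.
have n0 : 0 < N%:R :> K by rewrite ltr0n ltnW.
have N1K : 1 <= N%:R - 1%:R :> K by rewrite -natrB ?(ltnW N1) // ler1n subn_gt0.
rewrite /abel_coef subr0; have [hN|hN] := eqVneq (h N) +oo%E.
  rewrite /tail_ratio hN eqxx div1r lef_pV2 ?posrE ?ltr0n ?(ltnW N1) //.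
  by rewrite ler_nat.
have H0 := schedule_sum_gt0 sch hN.
have := hr _ (ltnW N1); have := hr _ N1.
rewrite !(tail_ratioS sch hN) ?(ltnW N1) //.
have := tail_ratio_mean_incr adm N1; have r0_ge0 := tail_ratio_ge0 0 sch.
rewrite subr0; set H := \sum_(0 <= i < _) _ in H0 *.
set s0 := tail_ratio N h 0 / _; set s1 := tail_ratio N h 1 / _ => s01.
have -> : tail_ratio N h 0 = N%:R * s0 by rewrite mulrC divfK ?gt_eqF.
have -> : tail_ratio N h 1 = (N%:R - 1%:R) * s1.
  by rewrite mulrC divfK ?gt_eqF // (lt_le_trans ltr01).
have s0_ge0 : 0 <= s0 by rewrite divr_ge0 // ltW.
move=> eq1 eq0; rewrite leNgt; apply/negP => s0_lt.
have {}eq0 : H * ((1 - N%:R * s0) * s0) = b 0%N.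
  by apply: (mulfI (lt0r_neq0 n0)); rewrite -eq0; ring.
have {}eq1 : H * ((N%:R * s0 - (N%:R - 1%:R) * s1) * s1) = b 1%N.
  apply: (@mulfI _ (N%:R - 1%:R)).
    by rewrite gt_eqF // (lt_le_trans ltr01).
  by rewrite -eq1; ring.
have s0_gt0 : 0 < s0.
  rewrite lt_neqAle s0_ge0 andbT; apply/eqP => s00.
  by move: b0; rewrite -eq0 -s00 !mulr0 ltxx.
have {}s0_lt : s0 < 1 - N%:R * s0.
  move: s0_lt; rewrite -[N.+1%:R^-1]div1r ltr_pdivlMr ?ltr0n //.
  by rewrite -natr1; lra.
have {}b01 : (1 - N%:R * s0) * s0 <= (N%:R * s0 - (N%:R - 1%:R) * s1) * s1.
  by rewrite -(ler_pM2l H0) eq0 eq1.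
have lt1 : s0 * s0 < (1 - N%:R * s0) * s0 by rewrite ltr_pM2r.
have fac : 0 <= ((N%:R - 1%:R) * s1 - s0) * (s1 - s0).
  rewrite mulr_ge0 // subr_ge0 // (le_trans s01) // ler_peMl //.
  exact: le_trans s01.
by have := lt_le_trans lt1 b01; rewrite -subr_gt0 => ?; lra.
Qed.

Lemma abel_coef_incr N h (b : nat -> K) k :
  admissible N h ->
  (forall k, (k < N)%N ->
     fine (h k) * tail_ratio N h k = (N%:R - k%:R) * b k) ->
  0 < b 0%N -> ((1 < N)%N -> b 0%N <= b 1%N) -> (k.+1 < N)%N ->
  abel_coef N h k <= abel_coef N h k.+1.
Proof.
move=> adm hr b0 b01; case: k => [|k] kN; first exact: abel_coef0_le (b01 kN).
exact: tail_ratio_mean_incr (ltnW kN).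
Qed.

(** With m = N - k and r' >= r the ratios before and at k, the weight is
    m r' / (m + 1) - (m - 1) r / m, where r >= 0 and (m - 1) (m + 1) <= m^2. *)
Lemma abel_coef_weight_ge0 N h k : schedule N h -> (k < N)%N ->
  0 <= abel_weight N (abel_coef N h) k.
Proof.
move=> sch kN; have := tail_ratio_le sch kN.
have := tail_ratio_ge0 k sch; set r := tail_ratio N h k.
have -> : abel_weight N (abel_coef N h) k =
    (N%:R - k%:R) * ((if k is i.+1 then tail_ratio N h i else 1)
                     / (N%:R - k%:R + 1))
    - (N%:R - k%:R - 1) * (r / (N%:R - k%:R)).
  rewrite /abel_weight /abel_coef /r -(natr1 k) opprD addrA.
  case: k {kN r} => [|k]; first by rewrite subr0 natr1 div1r.
  by rewrite -(natr1 k) opprD addrA subrK.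
set r' := if k is i.+1 then _ else _; set m := N%:R - k%:R => r0 rr'.
have m1 : 1 <= m by rewrite /m -natrB ?(ltnW kN) // ler1n subn_gt0.
have -> : m * (r' / (m + 1)) - (m - 1) * (r / m) =
    (m ^+ 2 * (r' - r) + r) / (m * (m + 1)).
  by field; rewrite !gt_eqF //; lra.
rewrite divr_ge0 ?addr_ge0 ?mulr_ge0 ?sqr_ge0 ?subr_ge0 //;
  rewrite ?ler_nat; first [exact: ltnW | lra].
Qed.

End Schedule.

(** * The optimization problem for the loss factor *)

Section LossFactor.
Context (K : realType).
Implicit Types (N : nat) (y z : nat -> K) (sigma t : K).

(** The feasible sequence that starts at t and satisfies every constraint with
    equality; it is the smallest one with this start, so that the minimization
    reduces to the single variable t. *)
Definition tight t (k : nat) : K := iter k (fun v => v + v ^+ 2) t.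

Lemma tightS t k : tight t k.+1 = tight t k + tight t k ^+ 2.
Proof. by []. Qed.

Lemma tight_feasible N t : 0 < t -> uL_feasible N (tight t).
Proof. by []. Qed.

Lemma feasible_gt0 N y k : uL_feasible N y -> (k <= N)%N -> 0 < y k.
Proof.
move=> [y0 y_step]; elim: k => // k IH kN.
apply: lt_le_trans (y_step k kN).
by rewrite ltr_wpDr ?sqr_ge0 // IH // ltnW.
Qed.

Lemma feasible_ge_init N y k : uL_feasible N y -> (k <= N)%N -> y 0%N <= y k.
Proof.
move=> [y0 y_step]; elim: k => // k IH kN.
apply: le_trans (y_step k kN).
by rewrite (le_trans (IH (ltnW kN))) // lerDl sqr_ge0.
Qed.

Lemma tight_le N y k : uL_feasible N y -> (k <= N)%N -> tight (y 0%N) k <= y k.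
Proof.
move=> fy; elim: k => // k IH kN.
have [y0 y_step] := fy.
apply: le_trans (y_step k kN); rewrite tightS lerD ?IH // ?(ltnW kN) //.
have /ltW r0 := feasible_gt0 (tight_feasible N y0) (ltnW kN).
by rewrite lerXn2r ?nnegrE ?(le_trans r0) ?IH // ltnW.
Qed.

Lemma objective_tight_le N sigma y : uL_feasible N y ->
  uL_objective N sigma (tight (y 0%N)) <= uL_objective N sigma y.
Proof.
move=> fy; have [y0 _] := fy; rewrite /uL_objective /=.
rewrite ler_wpM2r ?invr_ge0 ?mulr_ge0 ?(ltW y0) // lerD2l.
rewrite !big_mkord; apply: ler_sum => k _.
by rewrite (tight_le fy) // -ltnS.
Qed.

Lemma tight_continuous k : continuous (tight ^~ k).
Proof.
elim: k => [|k IH] t; first exact: cvg_id.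
apply: cvgD; first exact: IH.
exact: (continuous_cvg _ (@exprn_continuous _ 2 _) (IH t)).
Qed.

Lemma objective_tight_continuous N sigma t : 0 < t ->
  {for t, continuous (fun s => uL_objective N sigma (tight s))}.
Proof.
move=> t0; rewrite /uL_objective; apply: cvgM.
  apply: cvgD; first exact: cvg_cst.
  by apply: (cvg_big add_continuous) => k _; exact: tight_continuous.
apply: cvgV; first by rewrite mulf_neq0 ?pnatr_eq0 // gt_eqF.
by apply: cvgM; [exact: cvg_cst|exact: cvg_id].
Qed.

(** As a function of t = y_0, the objective is at least sigma^2 / ((N + 1) t),
    and, because y_1 >= t^2, at least t / (N + 1).  Outside [a, b] it exceeds
    its value at 1, and on [a, b] it attains its minimum. *)
Lemma uL_optimal_exists N sigma : (0 < N)%N -> 0 < sigma ->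
  exists y, uL_optimal N sigma y.
Proof.
move=> N0 sigma0; pose phi t := uL_objective N sigma (tight t).
have n0 : 0 < N.+1%:R :> K by rewrite ltr0n.
have sum_ge t : 0 < t -> t ^+ 2 <= \sum_(0 <= k < N.+1) tight t k.
  move=> t0; rewrite big_mkord (bigD1 (Ordinal (N0 : (1 < N.+1)%N))) //=.
  apply: (@le_trans _ _ (t + t ^+ 2)); first by rewrite lerDr ltW.
  rewrite lerDl sumr_ge0 // => k _.
  apply/ltW/(feasible_gt0 (tight_feasible N t0)).
  by rewrite -ltnS.
have phi_ge1 t : 0 < t -> sigma ^+ 2 / (N.+1%:R * t) <= phi t.
  move=> t0; rewrite /phi /uL_objective ler_wpM2r //.
    by rewrite invr_ge0 mulr_ge0 // ltW.
  by rewrite lerDl (le_trans _ (sum_ge t t0)) ?sqr_ge0.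
have phi_ge2 t : 0 < t -> t / N.+1%:R <= phi t.
  move=> t0; rewrite /phi /uL_objective ler_pdivlMr ?mulr_gt0 //.
  have -> : t / N.+1%:R * (N.+1%:R * t) = t ^+ 2.
    by field; rewrite gt_eqF.
  by rewrite (le_trans (sum_ge t t0)) // lerDr sqr_ge0.
pose a := sigma ^+ 2 / (N.+1%:R * phi 1); pose b := N.+1%:R * phi 1.
have M0 : 0 < phi 1 by apply: lt_le_trans (phi_ge2 1 ltr01); rewrite divr_gt0.
have nM0 : 0 < N.+1%:R * phi 1 by exact: mulr_gt0.
have a0 : 0 < a by apply: divr_gt0; [exact: exprn_gt0|].
have a1 : a <= 1.
  rewrite /a ler_pdivrMr // mul1r mulrC -ler_pdivrMr //.
  by have := phi_ge1 1 ltr01; rewrite mulr1.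
have b1 : 1 <= b.
  by rewrite /b mulrC -ler_pdivrMr // phi_ge2.
have [|c] := @EVT_min K phi a b (le_trans a1 b1).
  apply: continuous_in_subspaceT => t; rewrite inE /= in_itv /= => /andP[at_ _].
  exact: objective_tight_continuous (lt_le_trans a0 at_).
rewrite in_itv /= => /andP[ac cb] c_min.
have c0 := lt_le_trans a0 ac.
have c_min1 : phi c <= phi 1 by apply: c_min; rewrite in_itv /= a1.
exists (tight c); split=> [|z fz]; first exact: tight_feasible.
apply: le_trans (objective_tight_le _ fz); rewrite -/(phi _) -/(phi _).
have [z0 _] := fz.
have [lt_a|ge_a] := ltP (z 0%N) a.
  apply: le_trans c_min1 (le_trans _ (phi_ge1 _ z0)).
  rewrite ler_pdivlMr; last exact: mulr_gt0.
  have -> : phi 1 * (N.+1%:R * z 0%N) = z 0%N * (N.+1%:R * phi 1) by ring.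
  by rewrite -ler_pdivlMr // ltW.
have [lt_b|ge_b] := ltP b (z 0%N).
  apply: le_trans c_min1 (le_trans _ (phi_ge2 _ z0)).
  by rewrite ler_pdivlMr // mulrC ltW.
by apply: c_min; rewrite in_itv /= ge_a.
Qed.

Lemma uL_sqr N sigma y : uL_optimal N sigma y ->
  uL N sigma ^+ 2 = uL_objective N sigma y.
Proof.
move=> [fy y_min]; rewrite /uL.
have -> : inf [set uL_objective N sigma y | y in uL_feasible N]%classic =
    uL_objective N sigma y.
  apply/eqP; rewrite eq_le; apply/andP; split.
    apply: ge_inf; last by exists y.
    by exists (uL_objective N sigma y) => _ [z fz <-]; exact: y_min.
  apply: lb_le_inf; first by exists (uL_objective N sigma y), y.
  by move=> _ [z fz <-]; exact: y_min.
rewrite sqr_sqrtr // divr_ge0 ?mulr_ge0 ?(ltW fy.1) //.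
rewrite addr_ge0 ?sqr_ge0 // big_mkord sumr_ge0 // => k _.
by apply/ltW/(feasible_gt0 fy); rewrite -ltnS.
Qed.

Lemma uL_gt0 N sigma y : uL_optimal N sigma y -> 0 < uL N sigma.
Proof.
move=> opt; have [fy _] := opt.
rewrite lt_neqAle sqrtr_ge0 andbT eq_sym -sqrf_eq0 (uL_sqr opt).
rewrite gt_eqF // divr_gt0 ?mulr_gt0 ?ltr0n ?fy.1 //.
rewrite ltr_wpDl ?sqr_ge0 // big_nat_recl // ltr_wpDr ?fy.1 //.
rewrite big_mkord sumr_ge0 // => k _.
by apply/ltW/(feasible_gt0 fy).
Qed.

Lemma uL_ge1 N : 1 <= uL N (0 : K).
Proof.
rewrite /uL -{1}sqrtr1; apply: ler_wsqrtr.
apply: lb_le_inf; first by exists (uL_objective N 0 (tight 1)), (tight 1).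
move=> _ [y fy <-]; have [y0 _] := fy.
rewrite /uL_objective ler_pdivlMr ?mulr_gt0 ?ltr0n // mul1r expr0n /= add0r.
rewrite big_mkord mulr_natl -[X in _ *+ X]card_ord -sumr_const.
rewrite ler_sum // => k _.
by rewrite (feasible_ge_init fy) // -ltnS.
Qed.

Lemma powR32 (a : K) : 0 < a -> a `^ (3 / 2) = a * Num.sqrt a.
Proof.
move=> a0; have -> : 3 / 2 = 1 + 2^-1 :> K by lra.
by rewrite powRD ?gt_eqF ?implybT // powRr1 ?ltW // powR12_sqrt // ltW.
Qed.

(** The value of b_0 that makes the two terms R^2 / (2 (N + 1)^2 b_0) and
    b_0 L^2 (N + 1) uL^2 / 2 of the final bound equal. *)
Definition base_weight N (L R sigma : K) : K :=
  R / (L * (N.+1%:R * Num.sqrt N.+1%:R * uL N sigma)).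

Lemma alphaL_weights N (L R sigma : K) (rho : nat -> K) h :
  admissible_for N (alphaL N L R sigma rho) h ->
  admissible_for N
    (fun k => (N%:R - k%:R) * (base_weight N L R sigma * rho k)) h.
Proof.
move=> [adm hr]; split=> // k kN; rewrite hr // /alphaL /base_weight powR32 //.
rewrite natrB 1?ltnW // !invfM; ring.
Qed.

End LossFactor.

(** * The guarantees *)

Section Guarantee.
Context (K : realType) (X : completeNormedModType K).
Context (ip : {dot X for idfun}) (ip_norm : induces_norm ip).

Lemma run_bound N (x0 xstar : X) (L R : K) (f : X -> K) (h : nat -> \bar K)
    (b eta : nat -> K) (x g e : nat -> X) :
  admissible_for N (fun k => (N%:R - k%:R) * b k) h ->
  convex_class ip x0 L R f xstar -> subgradient_run ip f x0 N h x g e ->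
  0 < b 0%N -> (forall k, (k < N)%N -> b k <= b k.+1) ->
  (forall k v, (k < N)%N ->
     - b k * ip v (e k) - (b k.+1 - b k) / 2 * `|v| ^+ 2 <= eta k) ->
  f (output N h x) - f xstar <= R ^+ 2 / (2 * N.+1%:R ^+ 2 * b 0%N)
    + L ^+ 2 / 2 * (\sum_(k < N.+1) b k) + \sum_(k < N) eta k.
Proof.
move=> [adm hr] cvx [x0E run] b0 b_incr eta_ge; have [sch _] := adm.
have b_ge0 k : (k <= N)%N -> 0 <= b k.
  elim: k => [|k IH] kN; first exact: ltW.
  exact: le_trans (IH (ltnW kN)) (b_incr k kN).
apply: (output_gap_le ip_norm (h := fine \o h) (c := abel_coef N h) (g := g)
  (e := e) cvx x0E) => //.
- rewrite outputE // x0E; congr (_ + _); apply: eq_bigr => i _ /=.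
  by rewrite mulrC divfK // subr_eq0 eqr_nat gtn_eqF.
- move=> k kN; apply: (abel_coef_incr adm hr) => // N1.
  by rewrite b_incr // ltnW.
- by move=> k kN; exact: abel_coef_weight_ge0.
- move=> k kN /=; rewrite mulrA hr // mulrAC divff ?mul1r //.
  by rewrite subr_eq0 eqr_nat gtn_eqF.
Qed.

(** The weights are b_k = theta y_k with theta = b_0 / y_0.  The constraint on y
    reads theta (b_(k+1) - b_k) >= b_k^2, which is exactly what makes
    theta |e_k|^2 / 2 an admissible price for the error e_k.  The total price
    theta gamma^2 / 2 and the sum of the weights combine to the objective at y,
    which is uL^2. *)
Lemma guarantee_optimal N (x0 : X) (L R gamma : K) (y : nat -> K)
    (h : nat -> \bar K) : 0 < L -> 0 < R ->
  uL_optimal N (gamma / L) y ->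
  admissible_for N (alphaL N L R (gamma / L) (fun k => y k / y 0%N)) h ->
  guarantees ip x0 L R gamma N h
    (R * L / Num.sqrt N.+1%:R * uL N (gamma / L)).
Proof.
move=> L0 R0 opt /alphaL_weights adm f xstar x g e cvx run e_le.
have u0 := uL_gt0 opt; have u2 := uL_sqr opt; have [fy _] := opt.
have [y0 y_step] := fy.
set beta := base_weight _ _ _ _ in adm; set u := uL _ _ in u0 u2 *.
have n0 : 0 < N.+1%:R :> K by rewrite ltr0n.
have s0 : 0 < Num.sqrt N.+1%:R :> K by rewrite sqrtr_gt0.
have s2 : Num.sqrt N.+1%:R ^+ 2 = N.+1%:R :> K by rewrite sqr_sqrtr ?ltW.
have beta0 : 0 < beta by rewrite divr_gt0 ?mulr_gt0.
pose theta := beta / y 0%N.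
have theta0 : 0 < theta by rewrite divr_gt0.
have bE k : beta * (y k / y 0%N) = theta * y k by rewrite /theta; ring.
have b_step k : (k < N)%N ->
    theta * y k ^+ 2 <= beta * (y k.+1 / y 0%N) - beta * (y k / y 0%N).
  move=> kN; rewrite !bE -mulrBr ler_pM2l // lerBrDl; exact: y_step.
have := run_bound (eta := fun k => theta / 2 * `|e k| ^+ 2) adm cvx run.
rewrite divff ?gt_eqF // mulr1 => /(_ beta0) bound.
apply: le_trans (bound _ _) _.
- move=> k kN; rewrite -subr_ge0 (le_trans _ (b_step k kN)) //.
  by rewrite mulr_ge0 ?sqr_ge0 // ltW.
- move=> k v kN; have := b_step k kN; rewrite bE.
  have := normD_sqr ip_norm (e k) (y k *: v).
  rewrite ipZr (ipC ip (e k)) normrZ exprMn real_normK ?num_real // => sqE.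
  have v0 := sqr_ge0 `|v|.
  have := ler_wpM2r v0 => /[apply].
  have := mulr_ge0 (ltW theta0) (sqr_ge0 `|e k + y k *: v|).
  rewrite sqE !bE; lra.
have -> : \sum_(k < N) theta / 2 * `|e k| ^+ 2 =
    theta / 2 * \sum_(0 <= k < N) `|e k| ^+ 2 by rewrite big_mkord mulr_sumr.
have -> : \sum_(k < N.+1) beta * (y k / y 0%N) =
    theta * \sum_(0 <= k < N.+1) y k.
  by rewrite big_mkord mulr_sumr; apply: eq_bigr => k _; exact: bE.
set Y := \sum_(0 <= k < N.+1) y k; set E2 := \sum_(0 <= k < N) _ in e_le *.
have e_le' : theta / 2 * E2 <= theta / 2 * gamma ^+ 2.
  by rewrite ler_wpM2l // divr_ge0 // ltW.
apply: le_trans (lerD (lexx _) e_le') _.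
have YE : (gamma / L) ^+ 2 + Y = u ^+ 2 * (N.+1%:R * y 0%N).
  by rewrite u2 /uL_objective divfK // gt_eqF // mulr_gt0.
have -> : L ^+ 2 / 2 * (theta * Y) =
    L ^+ 2 * theta / 2 * (u ^+ 2 * (N.+1%:R * y 0%N)) - theta / 2 * gamma ^+ 2.
  by rewrite -YE; field; rewrite gt_eqF.
rewrite addrA subrK /theta /beta /base_weight -/u.
set s := Num.sqrt _ in s0 s2 *; rewrite -s2 le_eqVlt; apply/predU1P; left.
by field; rewrite !gt_eqF.
Qed.

(** All errors vanish, so the weights may be constant, and the bound obtained is
    R L (u + 1/u) / (2 sqrt (N + 1)) with u = uL.  It suffices that u >= 1. *)
Lemma guarantee_noiseless N (x0 : X) (L R : K) (h : nat -> \bar K) :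
  0 < L -> 0 < R ->
  admissible_for N (alphaL N L R 0 (fun=> 1)) h ->
  guarantees ip x0 L R 0 N h (R * L / Num.sqrt N.+1%:R * uL N 0).
Proof.
move=> L0 R0 /alphaL_weights adm f xstar x g e cvx run e_le.
have u1 := uL_ge1 K N; set beta := base_weight _ _ _ _ in adm.
set u := uL _ _ in u1 *; have u0 : 0 < u := lt_le_trans ltr01 u1.
have n0 : 0 < N.+1%:R :> K by rewrite ltr0n.
have s0 : 0 < Num.sqrt N.+1%:R :> K by rewrite sqrtr_gt0.
have s2 : Num.sqrt N.+1%:R ^+ 2 = N.+1%:R :> K by rewrite sqr_sqrtr ?ltW.
have beta0 : 0 < beta by rewrite divr_gt0 ?mulr_gt0.
have e0 k : (k < N)%N -> e k = 0.
  move=> kN; apply/eqP; rewrite -normr_eq0 -sqrf_eq0 eq_le sqr_ge0 andbT.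
  move: e_le; rewrite expr0n /= big_mkord (bigD1 (Ordinal kN)) //=.
  apply: le_trans; rewrite lerDl sumr_ge0 // => i _; exact: sqr_ge0.
have := run_bound (eta := fun=> 0) adm cvx run.
rewrite mulr1 => /(_ beta0) bound; apply: le_trans (bound _ _) _ => //.
  by move=> k v kN; rewrite e0 // linear0r mulr0 subrr !mul0r subrr.
rewrite [X in _ + X <= _]big1 // addr0.
have -> : \sum_(k < N.+1) beta = N.+1%:R * beta.
  by rewrite sumr_const card_ord mulr_natl.
have -> : R ^+ 2 / (2 * N.+1%:R ^+ 2 * beta) + L ^+ 2 / 2 * (N.+1%:R * beta) =
    R * L / Num.sqrt N.+1%:R * ((u + u^-1) / 2).
  rewrite /beta /base_weight -/u; set s := Num.sqrt _ in s0 s2 *.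
  by rewrite -s2; field; rewrite !gt_eqF.
rewrite ler_pM2l ?divr_gt0 ?mulr_gt0 //.
have : u^-1 <= u by rewrite (le_trans _ u1) // invf_le1.
lra.
Qed.

End Guarantee.

(* For gamma = 0 the infimum defining uL is not attained: along minimizing
   sequences y 0 tends to 0 and the quotients y k / y 0 tend to 1.  The last
   clause is the corresponding limit case. *)
Theorem proposition2 (K : realType) (X : completeNormedModType K)
  (ip : {dot X for idfun}) (ip_norm : induces_norm ip) (x0 : X)
  (N : nat) (N_ge1 : (1 <= N)%N)
  (L R gamma : K) (L_gt0 : 0 < L) (R_gt0 : 0 < R) (gamma_ge0 : 0 <= gamma) :
  let sigma := gamma / L in
  let bound := R * L / Num.sqrt N.+1%:R * uL N sigma in
  [/\ 0 < gamma -> exists y : nat -> K, uL_optimal N sigma y,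
      forall (y : nat -> K) (h : nat -> \bar K),
        uL_optimal N sigma y ->
        admissible_for N (alphaL N L R sigma (fun k => y k / y 0%N)) h ->
        guarantees ip x0 L R gamma N h bound
    & gamma = 0 ->
      forall h : nat -> \bar K,
        admissible_for N (alphaL N L R sigma (fun=> 1)) h ->
        guarantees ip x0 L R gamma N h bound].
Proof.
move=> sigma bound; split.
- by move=> gamma0; apply: uL_optimal_exists => //; exact: divr_gt0.
- by move=> y h; exact: guarantee_optimal.
- move=> gamma0 h; rewrite /bound /sigma gamma0 mul0r.
  exact: guarantee_noiseless.
Qed.
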